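(* A finite simple graph $G$ is a proper $k$-color-line graph if and only if $G$ admits a vertex clique partition $V(G)=Q_1\cup\dots\cup Q_k$ such that the graph $G\setminus\big(\bigcup_{1\le i\le k}E(Q_i)\big)$, obtained from $G$ by deleting all edges with both endpoints in a common $Q_i$, is a line graph.
   Context: A vertex clique partition $V(G)=Q_1\cup\dots\cup Q_k$ means the $Q_i$ are pairwise disjoint cliques of $G$ (sets of pairwise adjacent vertices) whose union is $V(G)$. An edge $k$-coloring of a graph $H$ is a map $\phi:E(H)\to\{1,\dots,k\}$; it is proper if any two distinct edges sharing an endvertex get different colors. For an edge-colored graph $(H,\phi)$, the color-line graph $\mathrm{CL}(H)$ has vertex set $E(H)$, two distinct vertices being adjacent iff the corresponding edges of $H$ share an endvertex or have the same color. $G$ is a proper $k$-color-line graph if $G\cong\mathrm{CL}(H)$ for some graph $H$ with a proper edge $k$-coloring. The line graph $L(H)$ has vertex set $E(H)$, two edges adjacent iff they share an endvertex; a line graph is a graph isomorphic to some $L(H)$. $E(Q)$ denotes the set of edges of $G$ with both endpoints in $Q$. *)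

(* Defs.v *)
From HB Require Import structures.
From mathcomp Require Import all_boot.

Set Implicit Arguments.
Unset Strict Implicit.
Unset Printing Implicit Defensive.

Record sgraph := SGraph {
  vertex :> finType;
  adj : rel vertex;
  adj_sym : symmetric adj;
  adj_irr : irreflexive adj }.

Definition edge_set (G : sgraph) : {set {set G}} :=
  [set E | [exists x : G, exists y : G, adj x y && (E == [set x; y])]].

Definition edge (G : sgraph) : finType := {E : {set G} | E \in edge_set G}.

Definition incident (G : sgraph) (a b : edge G) : bool :=
  [exists x : G, (x \in val a) && (x \in val b)].

Lemma incident_sym (G : sgraph) : symmetric (@incident G).
Proof. by move=> a b; apply: eq_existsb => x; rewrite andbC. Qed.

Definition isomorphic (G1 G2 : sgraph) : Prop :=
  exists f : G1 -> G2, bijective f /\ {mono f : x y / adj x y}.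

Definition line_adj (H : sgraph) : rel (edge H) :=
  fun a b => (a != b) && incident a b.

Lemma line_adj_sym (H : sgraph) : symmetric (@line_adj H).
Proof. by move=> a b; rewrite /line_adj eq_sym incident_sym. Qed.

Lemma line_adj_irr (H : sgraph) : irreflexive (@line_adj H).
Proof. by move=> a; rewrite /line_adj eqxx. Qed.

Definition line_graph (H : sgraph) : sgraph :=
  SGraph (@line_adj_sym H) (@line_adj_irr H).

Definition is_line_graph (G : sgraph) : Prop :=
  exists H : sgraph, isomorphic G (line_graph H).

Definition proper_edge_coloring (H : sgraph) (k : nat)
    (phi : edge H -> 'I_k) : Prop :=
  forall a b : edge H, a != b -> incident a b -> phi a != phi b.

Definition color_line_adj (H : sgraph) (k : nat) (phi : edge H -> 'I_k) :
    rel (edge H) :=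
  fun a b => (a != b) && (incident a b || (phi a == phi b)).

Lemma color_line_adj_sym (H : sgraph) (k : nat) (phi : edge H -> 'I_k) :
  symmetric (color_line_adj phi).
Proof.
by move=> a b; rewrite /color_line_adj eq_sym incident_sym [phi a == _]eq_sym.
Qed.

Lemma color_line_adj_irr (H : sgraph) (k : nat) (phi : edge H -> 'I_k) :
  irreflexive (color_line_adj phi).
Proof. by move=> a; rewrite /color_line_adj eqxx. Qed.

Definition color_line_graph (H : sgraph) (k : nat) (phi : edge H -> 'I_k) :
    sgraph :=
  SGraph (color_line_adj_sym phi) (color_line_adj_irr phi).

Definition is_proper_color_line_graph (k : nat) (G : sgraph) : Prop :=
  exists (H : sgraph) (phi : edge H -> 'I_k),
    proper_edge_coloring phi /\ isomorphic G (color_line_graph phi).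

Definition clique (G : sgraph) (Q : {set G}) : Prop :=
  {in Q &, forall x y, x != y -> adj x y}.

(* As colorings need not be surjective, parts are allowed to be empty. *)
Definition clique_partition (G : sgraph) (k : nat) (Q : 'I_k -> {set G}) :
    Prop :=
  [/\ forall i, clique (Q i),
      forall i j, i != j -> [disjoint Q i & Q j]
    & \bigcup_(i < k) Q i = [set: G]].

Definition edges_within (G : sgraph) (Q : {set G}) : {set {set G}} :=
  [set E in edge_set G | E \subset Q].

Definition del_adj (G : sgraph) (F : {set {set G}}) : rel G :=
  fun x y => adj x y && ([set x; y] \notin F).

Lemma del_adj_sym (G : sgraph) (F : {set {set G}}) : symmetric (del_adj F).
Proof. by move=> x y; rewrite /del_adj adj_sym setUC. Qed.

Lemma del_adj_irr (G : sgraph) (F : {set {set G}}) : irreflexive (del_adj F).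
Proof. by move=> x; rewrite /del_adj adj_irr. Qed.

Definition del_edges (G : sgraph) (F : {set {set G}}) : sgraph :=
  SGraph (del_adj_sym F) (del_adj_irr F).

(* Main.v *)
(** A vertex clique partition into [k] labelled parts is the same as a map
    [c : G -> 'I_k] whose fibres are cliques, and deleting the edges inside the
    parts keeps exactly the adjacent pairs with different values of [c].
    Under an identification of the vertices of [G] with the edges of [H], [c] is
    an edge coloring of [H]: its properness says that no two incident edges lie
    in the same part, so that deleting the edges inside the parts turns the
    color-line graph of [H] into its line graph, and conversely. *)

Require Import Defs.
From HB Require Import structures.
From mathcomp Require Import all_boot.

Set Implicit Arguments.
Unset Strict Implicit.
Unset Printing Implicit Defensive.

Lemma clique_partition_fibres (G : sgraph) (k : nat) (c : G -> 'I_k) :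
  (forall x y, x != y -> c x = c y -> adj x y) ->
  clique_partition (fun i => [set x | c x == i]).
Proof.
move=> c_adj; split=> [i x y | i j ij |].
- by rewrite !inE => /eqP cx /eqP cy /c_adj; apply; rewrite cx cy.
- apply/pred0P=> x; rewrite !inE.
  by apply: contraNF ij => /andP[/eqP<- /eqP<-].
- by apply/setP=> x; rewrite in_setT; apply/bigcupP; exists (c x); rewrite ?inE.
Qed.

(** Covering gives each vertex some part, chosen as [c x]; disjointness makes it the only one. *)
Lemma fibres_of_clique_partition (G : sgraph) (k : nat) (Q : 'I_k -> {set G}) :
  clique_partition Q ->
  exists2 c : G -> 'I_k, forall i, Q i = [set x | c x == i]
    & forall x y, x != y -> c x = c y -> adj x y.
Proof.
case=> cliqueQ disjQ coverQ.
have inQ x : exists i, x \in Q i.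
  have: x \in \bigcup_(i < k) Q i by rewrite coverQ in_setT.
  by case/bigcupP=> i _ Qix; exists i.
pose c x := xchoose (inQ x).
have Qc x : x \in Q (c x) := xchooseP (inQ x).
exists c => [i | x y xy cxy]; last first.
  by apply: (cliqueQ (c x)) => //; rewrite cxy.
apply/setP=> x; rewrite inE; apply/idP/eqP=> [Qix | <- //].
apply/eqP; apply: contraT => /disjQ/disjointFr/(_ (Qc x)).
by rewrite Qix.
Qed.

Lemma del_adj_fibresE (G : sgraph) (k : nat) (Q : 'I_k -> {set G})
    (c : G -> 'I_k) (x y : G) :
  (forall i, Q i = [set z | c z == i]) ->
  del_adj (\bigcup_(i < k) edges_within (Q i)) x y = adj x y && (c x != c y).
Proof.
move=> Qc; rewrite /del_adj; case xy: (adj x y) => //=; congr negb.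
apply/bigcupP/eqP=> [[i _] | cxy].
  by rewrite inE subUset !sub1set Qc !inE => /andP[_ /andP[/eqP-> /eqP->]].
exists (c x) => //; rewrite inE subUset !sub1set Qc !inE cxy eqxx !andbT.
by apply/existsP; exists x; apply/existsP; exists y; rewrite xy eqxx.
Qed.

Theorem theorem7 (k : nat) (G : sgraph) :
  is_proper_color_line_graph k G <->
  exists Q : 'I_k -> {set G},
    clique_partition Q /\
    is_line_graph (del_edges (\bigcup_(i < k) edges_within (Q i))).
Proof.
split.
  case=> H [phi [phi_proper [f [f_bij f_mono]]]].
  have f_inj := bij_inj f_bij.
  exists (fun i => [set x | phi (f x) == i]); split.
    apply: clique_partition_fibres => x y xy phixy; rewrite -f_mono /=.
    by rewrite /color_line_adj inj_eq // xy phixy eqxx orbT.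
  exists H, f; split=> // x y /=.
  rewrite (@del_adj_fibresE _ _ _ (phi \o f)) // -f_mono /=.
  rewrite /line_adj /color_line_adj -andbA; case fxy: (f x != f y) => //=.
  (* Non-incident edges are adjacent only through a common color, which the deletion excludes;
     incident ones differ in color by properness. *)
  case inc: (incident _ _) => /=; last by case: eqP.
  by rewrite phi_proper.
case=> Q [/fibres_of_clique_partition[c Qc c_adj] [H [f [f_bij f_mono]]]].
have f_eq (x y : G) : (f x == f y) = (x == y) := inj_eq (bij_inj f_bij) x y.
have {}f_mono (x y : G) : line_adj (f x) (f y) = adj x y && (c x != c y).
  by rewrite -(del_adj_fibresE _ _ Qc); apply: f_mono.
have [g fK gK] := f_bij.
(* An edge of [H] is colored by the part of its vertex. Incident edges come from a pair that
   survives the deletion, hence from different parts. *)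
exists H, (c \o g); split=> [a b ab inc /= |].
  have: line_adj a b by rewrite /line_adj ab.
  by rewrite -[a]gK -[b]gK f_mono !fK => /andP[].
exists f; split=> // x y; rewrite /= /color_line_adj /= !fK andb_orr.
rewrite -/(line_adj (f x) (f y)) f_mono f_eq.
have [-> | xy] := eqVneq x y; first by rewrite adj_irr.
(* Within a part both sides are true, the part being a clique; across parts only incidence
   counts. *)
by case: eqVneq => [/(c_adj _ _ xy)-> | _]; rewrite ?orbT ?andbT ?orbF.
Qed.
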